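(* Let a motif specification on $p,L$ have no constants (every $\pi_m$ is a partition of all of $\{1,\dots,L\}$) and a uniform hypergraph with edge size $n$ (every block of every $\pi_m$ has exactly $n$ elements). Assume the coordinates are ordered so that the indices $m$ sharing the same partition $\pi_m$ form contiguous ranges; let there be $q$ such ranges, of lengths $p_1,\dots,p_q$ in order ($p_1+\dots+p_q=p$). Then for every integer $r\ge0$, the maximum of $\mathcal M(\mathcal S)$ over subsets $\mathcal S\subseteq\mathbb{R}^p$ of size $r$ equals $r^{L/n}$, and a set $\mathcal S$ of size $r$ attains this maximum if and only if $\mathcal S=\mathcal S_1\times\cdots\times\mathcal S_q$ for some $\mathcal S_i\subseteq\mathbb{R}^{p_i}$, $i=1,\dots,q$.
   Context: A motif specification on $p,L$ (with no constants) is a sequence of partitions $\pi_1,\dots,\pi_p$ of $\{1,\dots,L\}$. A tuple $(f_1,\dots,f_L)\in(\mathbb{R}^p)^L$ is a motif if whenever $i,j$ lie in the same block of $\pi_m$ we have $(f_i)_m=(f_j)_m$. For $\mathcal S\subseteq\mathbb{R}^p$, $\mathcal M(\mathcal S)$ is the number of $L$-tuples of elements of $\mathcal S$ (repetitions allowed) that are motifs. The hypergraph of the specification has vertex set $\{1,\dots,L\}$ and one edge per block of each $\pi_m$. Convention: $0^0=1$. *)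

(* Defs.v *)
From HB Require Import structures.
From mathcomp Require Import all_boot all_order all_algebra.
From mathcomp Require Import finmap.
From mathcomp Require Import classical_sets reals.

Set Implicit Arguments.
Unset Strict Implicit.
Unset Printing Implicit Defensive.

Local Open Scope nat_scope.
Local Open Scope fset_scope.

(* The coordinates 1, ..., p are indexed by ['I_p] and the vertices 1, ..., L by
   ['I_L]; points of R^p are row vectors. *)

Definition motif_spec (p L : nat) (pi : 'I_p -> {set {set 'I_L}}) : Prop :=
  forall m, finset.partition (pi m) [set: 'I_L]%SET.

(* The edges form a multiset: a set of vertices that is a block of several
   partitions occurs once for each of them. *)
Definition hyperedges (p L : nat) (pi : 'I_p -> {set {set 'I_L}}) :
    seq {set 'I_L} :=
  flatten [seq enum (pi m) | m <- enum 'I_p].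

Definition uniform_hypergraph (p L : nat) (pi : 'I_p -> {set {set 'I_L}})
    (n : nat) : Prop :=
  forall e, e \in hyperedges pi -> #|e| = n.

Definition is_motif (R : realType) (p L : nat) (pi : 'I_p -> {set {set 'I_L}})
    (f : 'I_L -> 'rV[R]_p) : bool :=
  [forall m, forall B in pi m, forall i in B, forall j in B,
     f i ord0 m == f j ord0 m].

Definition num_motifs (R : realType) (p L : nat)
    (pi : 'I_p -> {set {set 'I_L}}) (S : {fset 'rV[R]_p}) : nat :=
  #|[set f : {ffun 'I_L -> S} | is_motif pi (fun i => fsval (f i))]%SET|.

(* ['I_(\sum_(i < q) ps i)] is cut into [q] successive ranges of lengths
   [ps 0, ..., ps (q - 1)], and [tagnat.sig1 m] is the index of the range
   containing [m]. So the ranges are exactly the maximal sets of indices sharing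
   the same partition, and they are contiguous. *)
Definition same_partition_ranges (q L : nat) (ps : 'I_q -> nat)
    (pi : 'I_(\sum_(i < q) ps i) -> {set {set 'I_L}}) : Prop :=
  (forall i, 0 < ps i) /\
  (forall m m', pi m = pi m' <-> tagnat.sig1 m = tagnat.sig1 m').

(* [submxrow x i] is the vector of the coordinates of [x] in the i-th range. *)
Definition block_product (R : realType) (q : nat) (ps : 'I_q -> nat)
    (T : forall i : 'I_q, set 'rV[R]_(ps i)) : set 'rV[R]_(\sum_(i < q) ps i) :=
  [set x | forall i, T i (submxrow x i)]%classic.

(* Main.v *)
(* Treat the coordinates of a range as one. The bound holds more generally for
   families (A_v): if f v is required to lie in A_v, then the number of motifs
   satisfies M^n <= prod_v #|A_v|. Induct on the coordinates: fixing the value of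
   one coordinate on every block of its partition cuts each A_v into slices, and
   the sum over those values factors into one Hoelder inequality per block.

   Equality for S forces equality in the family bound for every choice of slices
   of S along a coordinate i. Equality in the family bound forces A_u and A_v to
   take the same values in coordinate j when u and v share a block of the j-th
   partition: a point of A_u whose value is missing in A_v lies on no motif, so
   removing it would break the bound. Distinct partitions with equal block sizes
   have u and v in one block of the j-th partition but in distinct blocks of the
   i-th, so all slices along i have the same values in coordinate j; by induction
   each slice is a product, hence so is S. *)
Require Import Defs.
From mathcomp Require Import all_boot all_order all_algebra all_field.
From mathcomp Require Import finmap.
From mathcomp Require Import classical_sets reals.

Local Open Scope nat_scope.
Local Open Scope fset_scope.

(** * Hoelder's inequality for a finite product of functions *)

Section Holder.
Import Order.TTheory GRing.Theory Num.Theory.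
Local Open Scope ring_scope.

(** Divide each [G v] by its norm [a v]; the AM-GM inequality at each [c], summed over [c], then
    bounds the normalised sum by 1. A zero norm is treated apart: the left side vanishes. *)
Lemma holder_sum_prod (F : numClosedFieldType) (V C : finType) (B : {pred V})
    (G : V -> C -> F) :
  (0 < #|B|)%N -> (forall v c, 0 <= G v c) ->
  (\sum_c \prod_(v in B) G v c) ^+ #|B|
    <= \prod_(v in B) \sum_c G v c ^+ #|B|.
Proof.
set n := #|B| => n_gt0 G_ge0; pose s v := \sum_c G v c ^+ n.
have s_ge0 v : 0 <= s v by apply: sumr_ge0 => c _; apply: exprn_ge0.
have [/existsP[v /andP[vB /eqP sv0]] | s_neq0] :=
    boolP [exists v, (v \in B) && (s v == 0)].
  have Gv0 c : G v c = 0.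
    have /eqP : G v c ^+ n = 0.
      by apply: (psumr_eq0P _ sv0) => // c' _; apply: exprn_ge0.
    by rewrite expf_eq0 n_gt0 => /eqP.
  rewrite big1 => [|c _]; last by rewrite (bigD1 v)//= Gv0 mul0r.
  by rewrite expr0n gtn_eqF//=; apply: prodr_ge0 => w _; apply: s_ge0.
have s_gt0 v : v \in B -> 0 < s v.
  move=> vB; rewrite lt0r s_ge0 andbT; apply: contra s_neq0 => sv0.
  by apply/existsP; exists v; rewrite vB.
pose a v := n.-root (s v).
have a_gt0 v : v \in B -> 0 < a v by move=> vB; rewrite rootC_gt0 ?s_gt0.
have aX v : a v ^+ n = s v by rewrite rootCK.
pose h v c := G v c / a v.
have h_ge0 v c : v \in B -> 0 <= h v c.
  by move=> vB; rewrite divr_ge0// ltW ?a_gt0.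
have hX v : v \in B -> \sum_c h v c ^+ n = 1.
  move=> vB; under eq_bigr do rewrite expr_div_n.
  by rewrite -mulr_suml aX divff// gt_eqF ?s_gt0.
have hprod c : \prod_(v in B) h v c <= (\sum_(v in B) h v c ^+ n) / n%:R.
  rewrite -(@ler_pXn2r _ n)// ?nnegrE; first last.
  - rewrite divr_ge0 ?ler0n// sumr_ge0// => v vB.
    by rewrite exprn_ge0// h_ge0.
  - by apply: prodr_ge0 => v vB; apply: h_ge0.
  rewrite -prodrXl.
  by apply: (leif_AGM _ : _ <= _ ?= iff _) => v vB; rewrite exprn_ge0 ?h_ge0.
have hsum : \sum_c \prod_(v in B) h v c <= 1.
  apply: (le_trans (ler_sum _ (fun c _ => hprod c))).
  rewrite -mulr_suml exchange_big/= (eq_bigr (fun=> 1)) => [|v vB].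
    by rewrite sumr_const divff// pnatr_eq0 -lt0n.
  exact: hX.
have -> : \sum_c \prod_(v in B) G v c =
          (\prod_(v in B) a v) * \sum_c \prod_(v in B) h v c.
  rewrite mulr_sumr; apply: eq_bigr => c _; rewrite -big_split/=.
  by apply: eq_bigr => v vB; rewrite mulrC divfK// gt_eqF ?a_gt0.
rewrite exprMn -prodrXl; under eq_bigr do rewrite aX.
rewrite -[leRHS]mulr1 ler_wpM2l ?prodr_ge0// exprn_ile1//.
by apply: sumr_ge0 => c _; apply: prodr_ge0 => v vB; apply: h_ge0.
Qed.

End Holder.

(** * The bound for families and its equality case, over abstract coordinates *)

Section Motifs.
Import Order.TTheory GRing.Theory Num.Theory.
Import fintype boot.finset.
Set Implicit Arguments.
Unset Strict Implicit.

Variables (X V I K C : finType) (c : I -> X -> C) (b : I -> V -> K) (n : nat).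
Hypothesis n_gt0 : 0 < n.
Hypothesis card_fiber : forall i k, #|[pred v | b i v == k]| = n.

Implicit Types (i j : I) (D : {set I}) (A : V -> {set X}) (Y : {set X}).

(** [c i x] stands for the i-th coordinate of [x], and [b i v] for the block of [v] in the i-th
    partition. [D] holds the coordinates not yet fixed by slicing. *)
Definition motifs D A : {set {ffun V -> X}} :=
  [set f : {ffun V -> X} | [forall v, f v \in A v] &&
     [forall i in D, forall u, forall v,
        (b i u == b i v) ==> (c i (f u) == c i (f v))]]%SET.

Definition slice i Y a : {set X} := [set x in Y | c i x == a]%SET.

(** An invariant of slicing: a coordinate removed from [D] is constant on the slice, so the
    remaining ones still separate its points. *)
Definition coords_inj D Y :=
  {in Y &, forall x y, (forall i, i \in D -> c i x = c i y) -> x = y}.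

Lemma motifsP D A (f : {ffun V -> X}) :
  reflect ((forall v, f v \in A v) /\
           forall i, i \in D ->
             forall u v, b i u = b i v -> c i (f u) = c i (f v))
          (f \in motifs D A).
Proof.
rewrite inE; apply: (iffP andP) => -[/forallP fA fD]; split=> //.
- move=> i iD u v buv; move/forall_inP/(_ i iD): fD.
  by move=> /forallP/(_ u)/forallP/(_ v); rewrite buv eqxx => /eqP.
- apply/forall_inP => i iD; apply/forallP => u; apply/forallP => v.
  by apply/implyP => /eqP buv; apply/eqP/fD.
Qed.

Lemma eq_motifs D A A' : A =1 A' -> motifs D A = motifs D A'.
Proof.
move=> eqA; apply/setP => f.
by apply/motifsP/motifsP => -[fA fD]; split=> // v; move: (fA v); rewrite eqA.
Qed.

Lemma fiber_section : exists s : I -> K -> V, forall i k, b i (s i k) = k.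
Proof.
pose P i s := forall k, b i (s k) = k.
apply: (@fin_all_exists _ _ P) => i.
apply: (@fin_all_exists _ _ (fun k v => b i v = k)) => k.
have /card_gt0P[v] : 0 < #|[pred v | b i v == k]| by rewrite card_fiber.
by rewrite inE => /eqP; exists v.
Qed.

(** Coordinate [i] of a motif is constant on each block of the i-th partition, so it amounts to a
    function [y] on block indices, by which the motifs are sorted. *)
Lemma card_motifs_slice i D A : i \in D ->
  #|motifs D A| =
  \sum_(y : {ffun K -> C})
     #|motifs (D :\ i) (fun v => slice i (A v) (y (b i v)))|.
Proof.
move=> iD; have [s sK] := fiber_section.
pose p (f : {ffun V -> X}) := [ffun k => c i (f (s i k))].
rewrite -sum1_card (partition_big p xpredT)//=.
apply: eq_bigr => y _; rewrite -sum1_card; apply: eq_bigl => f.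
apply/andP/motifsP => [[/motifsP[fA fD] /eqP <-] | [fA fD]].
  split=> [v | j /setD1P[_ jD]]; last exact: fD.
  by rewrite inE fA ffunE; apply/eqP/fD => //; rewrite sK.
have fy v : f v \in A v /\ c i (f v) = y (b i v).
  by have := fA v; rewrite inE => /andP[-> /eqP].
split; last by apply/eqP/ffunP => k; rewrite ffunE (fy _).2 sK.
apply/motifsP; split=> [v | j jD u v]; first exact: (fy v).1.
have [-> buv | ji] := eqVneq j i; first by rewrite !(fy _).2 buv.
by apply: fD; rewrite !inE ji.
Qed.

Lemma sum_card_slice i Y : \sum_a #|slice i Y a| = #|Y|.
Proof.
rewrite -sum1_card (partition_big (c i) xpredT)//=.
apply: eq_bigr => a _; rewrite -sum1_card; apply: eq_bigl => x.
by rewrite inE.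
Qed.

Lemma slice_coords_inj i D Y a :
  coords_inj D Y -> coords_inj (D :\ i) (slice i Y a).
Proof.
move=> injY x y; rewrite !inE => /andP[xY /eqP xa] /andP[yY /eqP ya] xy.
apply: injY => // j jD; have [-> | ji] := eqVneq j i; first by rewrite xa ya.
by apply: xy; rewrite !inE ji.
Qed.

Lemma card_motifs_le D A : (forall v, coords_inj D (A v)) ->
  #|motifs D A| ^ n <= \prod_v #|A v|.
Proof.
have [m] := ubnP #|D|; elim: m => // m IHm in D A *; rewrite ltnS => leDm injA.
(* With no coordinate left, each [A v] has at most one point, so there is at most one motif. *)
have [D0 | [i iD]] := set_0Vmem D.
  have [-> | [f fDA]] := set_0Vmem (motifs D A); first by rewrite cards0 exp0n.
  have A_gt0 : 0 < \prod_v #|A v|.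
    rewrite prodn_gt0// => v; apply/card_gt0P; exists (f v).
    by have /motifsP[] := fDA.
  apply: leq_trans A_gt0; rewrite -(exp1n n) leq_exp2r//.
  rewrite -(cards1 f) subset_leq_card//; apply/subsetP => g gDA.
  rewrite inE; apply/eqP/ffunP => v.
  have [/motifsP[fA _] /motifsP[gA _]] := (fDA, gDA).
  by apply: (injA v) => // i; rewrite D0 inE.
(* Taking n-th roots puts the induction hypothesis in a form that can be summed over [y]. *)
pose g v a : algC := (n.-root #|slice i (A v) a|%:R)%R.
have g_ge0 v a : (0 <= g v a)%R by rewrite rootC_ge0 ?ler0n.
have gX v a : (g v a ^+ n = #|slice i (A v) a|%:R)%R by rewrite rootCK.
have card_le (y : {ffun K -> C}) :
    (#|motifs (D :\ i) (fun v => slice i (A v) (y (b i v)))|%:R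
       <= \prod_k \prod_(v | b i v == k) g v (y k))%R.
  rewrite -(@ler_pXn2r _ n)// ?nnegrE ?ler0n//; last first.
    by apply: prodr_ge0 => k _; apply: prodr_ge0.
  have -> : (\prod_k \prod_(v | b i v == k) g v (y k) =
             \prod_v g v (y (b i v)))%R.
    rewrite [RHS](partition_big (b i) xpredT)//=.
    by apply: eq_bigr => k _; apply: eq_bigr => v /eqP->.
  rewrite -prodrXl; under eq_bigr do rewrite gX.
  rewrite -natr_prod -natrX ler_nat; apply: IHm.
    by rewrite (cardsD1 i) iD in leDm.
  by move=> v; apply: slice_coords_inj.
rewrite -(ler_nat algC) natrX (card_motifs_slice _ iD).
rewrite natr_sum.
(* By distributivity the sum over [y] becomes a product over blocks, and Hoelder applies to each
   block. *)
apply: (@le_trans _ _ ((\prod_k \sum_a \prod_(v | b i v == k) g v a) ^+ n)%R).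
  rewrite bigA_distr_bigA/= lerXn2r ?nnegrE//.
  - exact: sumr_ge0.
  - apply: sumr_ge0 => y _.
    by apply: prodr_ge0 => k _; apply: prodr_ge0.
  - exact: ler_sum.
rewrite -prodrXl [X in (_ <= X%:R)%R](partition_big (b i) xpredT)//=.
rewrite natr_prod; apply: ler_prod => k _.
rewrite exprn_ge0/=; last first.
  by apply: sumr_ge0 => a _; apply: prodr_ge0.
have := @holder_sum_prod algC _ _ [pred v | b i v == k] g.
rewrite card_fiber => /(_ n_gt0 g_ge0) /le_trans; apply.
rewrite natr_prod; under eq_bigr do under eq_bigr do rewrite gX.
by under eq_bigr do rewrite -natr_sum sum_card_slice.
Qed.

Lemma motifs_extremal_coord D A j u v x :
    (forall w, coords_inj D (A w)) -> (forall w, 0 < #|A w|) ->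
    #|motifs D A| ^ n = \prod_w #|A w| ->
    j \in D -> b j u = b j v -> x \in A u ->
  exists2 x', x' \in A v & c j x' = c j x.
Proof.
move=> injA A_n0 eqA jD buv xAu.
have [/existsP[x' /andP[? /eqP ?]] | noex] :=
    boolP [exists x', (x' \in A v) && (c j x' == c j x)]; first by exists x'.
pose A' w := if w == u then A u :\ x else A w.
have A'sub w : A' w \subset A w.
  by rewrite /A'; case: eqP => [-> | _]; rewrite ?subD1set.
have eqmot : motifs D A = motifs D A'.
  apply/setP => f; apply/motifsP/motifsP => -[fA fD]; split=> // w; last first.
    exact: subsetP (A'sub w) _ (fA w).
  rewrite /A'; case: eqP => [-> | _]; last exact: fA.
  rewrite !inE fA andbT; apply: contraNneq noex => fux.
  by apply/existsP; exists (f v); rewrite fA -fux (fD j jD u v buv) eqxx.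
(* Passing to [A'] keeps all motifs but strictly lowers the product, whose factors at the other
   vertices are positive. *)
suff : \prod_w #|A w| < \prod_w #|A w| by rewrite ltnn.
rewrite -{1}eqA eqmot.
apply: (@leq_ltn_trans (\prod_w #|A' w|)).
  apply: card_motifs_le => w y z yA zA; apply: (injA w).
    exact: subsetP (A'sub w) _ yA.
  exact: subsetP (A'sub w) _ zA.
rewrite (bigD1 u)//= [ltnRHS](bigD1 u)//= {1}/A' eqxx.
rewrite (eq_bigr (fun w => #|A w|)) => [|w /negPf wu]; last by rewrite /A' wu.
rewrite ltn_pmul2r; first by rewrite [ltnRHS](cardsD1 x) xAu.
by rewrite prodn_gt0.
Qed.

Lemma expn_sum_prod (z : C -> nat) :
  (\sum_a z a) ^ #|K| = \sum_(y : {ffun K -> C}) \prod_k z (y k).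
Proof. by rewrite -(bigA_distr_bigA (fun=> z)) prod_nat_const. Qed.

Lemma prod_fiber i (z : K -> nat) : \prod_v z (b i v) = (\prod_k z k) ^ n.
Proof.
rewrite (partition_big (b i) xpredT)//=.
rewrite (big_morph (expn^~ n) (fun x y => expnMn x y n) (exp1n n)).
apply: eq_bigr => k _.
rewrite (eq_bigr (fun=> z k)) => [|v /eqP-> //].
by rewrite prod_nat_const card_fiber.
Qed.

(** The fibres of [b i] cut [V] into [#|K|] classes of size [n], so the family bound is an n-th
    power. *)
Lemma card_motifs_le_exp i D Y :
  coords_inj D Y -> #|motifs D (fun=> Y)| <= #|Y| ^ #|K|.
Proof.
move=> injY; rewrite -(leq_exp2r _ _ n_gt0).
apply: (@leq_trans (\prod_(v : V) #|Y|)); first exact: card_motifs_le.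
by rewrite (prod_fiber i (fun=> #|Y|)) prod_nat_const.
Qed.

(** Being a product is phrased as mixing: coordinates taken from different points of [Y] are
    assembled in one point of [Y]. *)
Lemma motifs_extremal_product D Y :
    (forall i j, i \in D -> j \in D -> i != j ->
       exists u v, b j u = b j v /\ b i u <> b i v) ->
    coords_inj D Y -> #|motifs D (fun=> Y)| = #|Y| ^ #|K| -> 0 < #|Y| ->
  forall g : I -> X, (forall i, i \in D -> g i \in Y) ->
  exists2 x, x \in Y & forall i, i \in D -> c i x = c i (g i).
Proof.
have [m] := ubnP #|D|; elim: m => // m IHm in D Y *.
rewrite ltnS => leDm sepD injY eqY Y_gt0 g gY.
have [-> | [i iD]] := set_0Vmem D.
  by have /card_gt0P[x xY] := Y_gt0; exists x => // j; rewrite inE.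
(* The bounds for the separate [y] add up to the bound for [Y], which is attained; hence each of
   them is attained. *)
have eq_slices (y : {ffun K -> C}) :
    #|motifs (D :\ i) (fun v => slice i Y (y (b i v)))| =
    \prod_k #|slice i Y (y k)|.
  have le_slices (y' : {ffun K -> C}) :
      #|motifs (D :\ i) (fun v => slice i Y (y' (b i v)))| <=
      \prod_k #|slice i Y (y' k)| ?= iff
      (#|motifs (D :\ i) (fun v => slice i Y (y' (b i v)))| ==
       \prod_k #|slice i Y (y' k)|).
    split=> //; rewrite -(leq_exp2r _ _ n_gt0).
    rewrite -(prod_fiber i (fun k => #|slice i Y (y' k)|)).
    by apply: card_motifs_le => v; apply: slice_coords_inj.
  have := leqif_sum (fun y' (_ : xpredT y') => le_slices y').
  rewrite -card_motifs_slice// -(expn_sum_prod (fun a => #|slice i Y a|)).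
  rewrite sum_card_slice eqY => -[_].
  by rewrite eqxx => /esym/forallP/(_ y)/eqP.
pose a := c i (g i).
have giY : g i \in slice i Y a by rewrite inE gY ?eqxx.
have a_gt0 : 0 < #|slice i Y a| by apply/card_gt0P; exists (g i).
have sepDi : forall j j', j \in D :\ i -> j' \in D :\ i -> j != j' ->
    exists u v, b j' u = b j' v /\ b j u <> b j v.
  by move=> j j' /setD1P[_ jD] /setD1P[_ j'D]; apply: sepD.
have Di_lt : #|D :\ i| < m by rewrite (cardsD1 i) iD in leDm.
have eqa : #|motifs (D :\ i) (fun=> slice i Y a)| = #|slice i Y a| ^ #|K|.
  have := eq_slices [ffun=> a].
  under [RHS]eq_bigr do rewrite ffunE.
  rewrite prod_nat_const => <-; congr #|pred_of_set _|.
  by apply: eq_motifs => v; rewrite ffunE.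
have ex_h j : exists hj : X, j \in D :\ i ->
    hj \in slice i Y a /\ c j hj = c j (g j).
  have [jDi | _] := boolP (j \in D :\ i); last by exists (g i).
  have /setD1P[ji jD] := jDi.
  have ij : i != j by rewrite eq_sym.
  have [u [v [bju bi_uv]]] := sepD i j iD jD ij.
  (* The slice at [u] contains [g j], the one at [v] is the slice at [a]. Since [u] and [v] share a
     block of the j-th partition, the value [c j (g j)] also occurs in the slice at [a]. *)
  pose y := [ffun k => if k == b i u then c i (g j) else a].
  have yu : y (b i u) = c i (g j) by rewrite ffunE eqxx.
  have yv : y (b i v) = a by rewrite ffunE; case: eqP => // /esym.
  have [||||||x'] := @motifs_extremal_coord (D :\ i)
      (fun w => slice i Y (y (b i w))) j u v (g j).
  - by move=> w; apply: slice_coords_inj.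
  - move=> w; rewrite ffunE; case: eqP => // _.
    by apply/card_gt0P; exists (g j); rewrite inE gY ?eqxx.
  - by rewrite eq_slices (prod_fiber i (fun k => #|slice i Y (y k)|)).
  - by [].
  - by [].
  - by rewrite yu inE gY ?eqxx.
  by rewrite yv; exists x'.
have [h hP] := fin_all_exists ex_h.
have [x xYa xh] := IHm _ _ Di_lt sepDi (slice_coords_inj injY) eqa a_gt0 h
  (fun j jDi => (hP j jDi).1).
move: xYa; rewrite inE => /andP[xY /eqP xa].
exists x => // j jD; have [-> // | ji] := eqVneq j i.
have jDi : j \in D :\ i by rewrite !inE ji.
by rewrite xh// (hP j jDi).2.
Qed.

(** Every choice of points [h k], one per block index, yields a motif: give [v] the point whose i-th
    coordinate is that of [h (b i v)]. A section of [b i] recovers [h]. *)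
Lemma card_motifs_product :
    (forall x y, (forall i, c i x = c i y) -> x = y) ->
    (forall g : I -> X, exists x, forall i, c i x = c i (g i)) ->
  #|X| ^ #|K| <= #|motifs [set: I] (fun=> [set: X])|.
Proof.
move=> injc prodX; have [s sK] := fiber_section.
have prodX' (g : {ffun I -> X}) : exists x, forall i, c i x = c i (g i).
  exact: prodX.
have [x xP] := fin_all_exists prodX'.
pose F (h : {ffun K -> X}) := [ffun v => x [ffun i => h (b i v)]].
have FE h i v : c i (F h v) = c i (h (b i v)) by rewrite ffunE xP ffunE.
rewrite -card_ffun -(@card_imset _ _ F) => [|h h' eqF].
  apply/subset_leq_card/subsetP => f /imsetP[h _ ->]; apply/motifsP.
  by split=> // i _ u v buv; rewrite !FE buv.
apply/ffunP => k; apply: injc => i.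
by rewrite -(sK i k) -!FE eqF.
Qed.

End Motifs.

(** * Numbering the blocks of a uniform partition *)

Section BlockIndex.
Import fintype boot.finset.

Variables (L n : nat) (P : {set {set 'I_L}}).
Hypothesis n_gt0 : 0 < n.
Hypothesis partP : partition P [set: 'I_L].
Hypothesis cardP : {in P, forall B : {set 'I_L}, #|B| = n}.

Lemma card_uniform_blocks : #|P| = L %/ n.
Proof.
have := card_uniform_partition cardP partP.
by rewrite cardsT card_ord => eqL; rewrite -(mulnK #|P| n_gt0) -eqL.
Qed.

Lemma mem_same_block u v B : B \in P -> u \in B ->
  (v \in B) = (pblock P u == pblock P v).
Proof.
have [/eqP covP tiP _] := and3P partP.
move=> BP uB; rewrite eq_pblock ?covP ?inE//.
by rewrite (def_pblock tiP BP uB).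
Qed.

(** The index of a block is its position in [enum P]. Equal block sizes give all the partitions the
    same index type. *)
Lemma exists_block_index : exists b : 'I_L -> 'I_(L %/ n),
  (forall u v, b u = b v <-> exists2 B, B \in P & (u \in B) && (v \in B)) /\
  forall k, #|[pred v | b v == k]| = n.
Proof.
have [/eqP covP tiP _] := and3P partP.
have inP v : pblock P v \in P by rewrite pblock_mem ?covP ?inE.
have inB v : v \in pblock P v by rewrite mem_pblock covP inE.
have ltP v : index (pblock P v) (enum P) < L %/ n.
  by rewrite -card_uniform_blocks cardE index_mem mem_enum.
exists (fun v => Ordinal (ltP v)); split=> [u v | k].
  split=> [[eq_index] | [B BP /andP[uB vB]]].
    have eq_uv : pblock P u = pblock P v.
      rewrite -(nth_index set0 (_ : pblock P u \in enum P)) ?mem_enum//.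
      by rewrite eq_index nth_index ?mem_enum.
    by exists (pblock P u) => //; rewrite inB eq_uv inB.
  apply: val_inj => /=; have := vB.
  by rewrite (mem_same_block v BP uB) => /eqP->.
have lt_k : k < size (enum P) by rewrite -cardE card_uniform_blocks.
pose B := nth set0 (enum P) k.
have BP : B \in P by rewrite -mem_enum mem_nth.
transitivity #|B|; last exact: cardP.
apply: eq_card => v; rewrite !inE -val_eqE/=.
apply/eqP/idP => [eqk | vB].
  by rewrite /B -eqk nth_index ?mem_enum.
by rewrite (def_pblock tiP BP vB) /B index_uniq ?enum_uniq.
Qed.

End BlockIndex.

Section UniformRefinement.
Import fintype boot.finset.

(** Each block of [P'] lies in a block of [P] of the same size, so it equals it; and both partitions
    have [L %/ n] blocks. *)
Lemma uniform_partition_refine (L n : nat) (P P' : {set {set 'I_L}}) :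
    0 < n ->
    partition P [set: 'I_L] -> {in P, forall B : {set 'I_L}, #|B| = n} ->
    partition P' [set: 'I_L] -> {in P', forall B : {set 'I_L}, #|B| = n} ->
    (forall u v B', B' \in P' -> u \in B' -> v \in B' ->
       exists2 B, B \in P & (u \in B) && (v \in B)) ->
  P' = P.
Proof.
move=> n_gt0 partP cardP partP' cardP' refP.
apply/eqP; rewrite eqEcard.
rewrite (card_uniform_blocks n_gt0 partP cardP).
rewrite (card_uniform_blocks n_gt0 partP' cardP') leqnn andbT.
apply/subsetP => B' B'P'.
have /card_gt0P[u uB'] : 0 < #|B'| by rewrite cardP'.
have [B BP /andP[uB _]] := refP u u B' B'P' uB' uB'.
suff -> : B' = B by [].
apply/eqP; rewrite eqEcard cardP// cardP'// leqnn andbT.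
apply/subsetP => v vB'.
have [B1 B1P /andP[uB1 vB1]] := refP u v B' B'P' uB' vB'.
by rewrite (mem_same_block partP v BP uB) -(mem_same_block partP v B1P uB1).
Qed.

End UniformRefinement.

(** * Back to row vectors: ranges of coordinates as single coordinates *)

Section Ranges.
Set Implicit Arguments.
Unset Strict Implicit.
Import fintype boot.finset.

Variables (R : realType) (L n q : nat) (ps : 'I_q -> nat).
Variable pi : 'I_(\sum_(i < q) ps i) -> {set {set 'I_L}}.
Hypothesis n_gt0 : 0 < n.
Hypothesis p_gt0 : 0 < \sum_(i < q) ps i.
Hypothesis pi_spec : motif_spec pi.
Hypothesis pi_unif : uniform_hypergraph pi n.
Hypothesis pi_ranges : same_partition_ranges pi.

Let point := 'rV[R]_(\sum_(i < q) ps i).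

Lemma card_block m (B : {set 'I_L}) : B \in pi m -> #|B| = n.
Proof.
move=> Bm; apply: pi_unif; apply/flatten_mapP.
by exists m; rewrite mem_enum.
Qed.

Lemma exists_range_block_index : exists b : 'I_q -> 'I_L -> 'I_(L %/ n),
  [/\ forall m u v, b (tagnat.sig1 m) u = b (tagnat.sig1 m) v <->
        exists2 B, B \in pi m & (u \in B) && (v \in B),
      forall i k, #|[pred v | b i v == k]| = n &
      forall i j, i != j -> exists u v, b j u = b j v /\ b i u <> b i v].
Proof.
have [ps_gt0 piE] := pi_ranges.
(* The first coordinate of each nonempty range represents its partition. *)
pose m i : 'I_(\sum_(i < q) ps i) := tagnat.Rank i (Ordinal (ps_gt0 i)).
have sig1m i : tagnat.sig1 (m i) = i by rewrite tagnat.Rank1K.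
have [b bP] := fin_all_exists (fun i =>
  exists_block_index n_gt0 (pi_spec (m i)) (@card_block (m i))).
have bE m' u v : b (tagnat.sig1 m') u = b (tagnat.sig1 m') v <->
    exists2 B, B \in pi m' & (u \in B) && (v \in B).
  have -> : pi m' = pi (m (tagnat.sig1 m')) by apply/piE; rewrite sig1m.
  exact: (bP _).1.
exists b; split=> // [i | i j ij]; first exact: (bP i).2.
have [/existsP[u /existsP[v /andP[/eqP ? /eqP ?]]] | no_uv] :=
  boolP [exists u, exists v, (b j u == b j v) && (b i u != b i v)].
  by exists u, v.
(* Without such a pair the j-th partition would refine the i-th, hence equal it, although distinct
   ranges have distinct partitions. *)
case/eqP: ij; rewrite -(sig1m i) -(sig1m j); apply/esym/piE.
apply: (uniform_partition_refine n_gt0 (pi_spec _) _ (pi_spec _)).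
- exact: card_block.
- exact: card_block.
move=> u v B BP uB vB; apply/bE; rewrite sig1m; apply/eqP.
apply: contraNT no_uv => bi_uv; apply/existsP; exists u.
apply/existsP; exists v.
rewrite bi_uv andbT -(sig1m j); apply/eqP/bE.
by exists B; rewrite ?uB.
Qed.

Section Points.

Variable S : {fset point}.

(* The coordinates in the i-th range, encoded in a finite type by the set of
   points that share them. *)
Definition range_class (i : 'I_q) (x : S) : {set S} :=
  [set y : S | submxrow (val y) i == submxrow (val x) i].

Lemma range_classE i x y :
  range_class i x = range_class i y <-> submxrow (val x) i = submxrow (val y) i.
Proof.
split=> [/setP/(_ x) | eqxy]; last by apply/setP => z; rewrite !inE eqxy.
by rewrite !inE eqxx => /esym/eqP.
Qed.

Lemma range_class_inj (x y : S) :
  (forall i, range_class i x = range_class i y) -> x = y.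
Proof.
by move=> eqxy; apply/val_inj/mxrowP => i; apply/range_classE.
Qed.

Lemma num_motifs_range (b : 'I_q -> 'I_L -> 'I_(L %/ n)) :
    (forall m u v, b (tagnat.sig1 m) u = b (tagnat.sig1 m) v <->
       exists2 B, B \in pi m & (u \in B) && (v \in B)) ->
  num_motifs pi S =
  #|motifs range_class b [set: 'I_q] (fun=> [set: S])|.
Proof.
have [ps_gt0 piE] := pi_ranges.
move=> bE; congr #|pred_of_set _|; apply/setP => f; rewrite [LHS]inE.
apply/forallP/motifsP => [mot_f | [_ mot_f] m].
  split=> [v | i _ u v buv]; first by rewrite inE.
  apply/range_classE/rowP => k; rewrite !mxE; apply/eqP.
  have [B Bm /andP[uB vB]] : exists2 B, B \in pi (tagnat.Rank i k) &
      (u \in B) && (v \in B) by apply/bE; rewrite tagnat.Rank1K.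
  move: (mot_f (tagnat.Rank i k)) => /forall_inP/(_ B Bm)/forall_inP/(_ u uB).
  by move=> /forall_inP/(_ v vB).
apply/forall_inP => B Bm; apply/forall_inP => u uB; apply/forall_inP => v vB.
have buv : b (tagnat.sig1 m) u = b (tagnat.sig1 m) v.
  by apply/bE; exists B; rewrite ?uB.
have /range_classE/rowP/(_ (tagnat.sig2 m)) := mot_f _ (in_setT _) u v buv.
by rewrite !mxE tagnat.sig2K => ->.
Qed.

Lemma num_motifs_le : num_motifs pi S <= #|` S| ^ (L %/ n).
Proof.
have [b [bE bfib _]] := exists_range_block_index.
rewrite (num_motifs_range bE) cardfE -cardsT.
have := card_motifs_le_exp n_gt0 bfib (tagnat.sig1 (Ordinal p_gt0)).
rewrite card_ord; apply=> x y _ _ eqxy.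
by apply: range_class_inj => i; apply: eqxy; rewrite inE.
Qed.

(** The empty set qualifies vacuously: [q > 0], so no [g] exists for it. *)
Definition range_mixing :=
  forall g : 'I_q -> S, exists x : S,
    forall i, submxrow (val x) i = submxrow (val (g i)) i.

Lemma num_motifs_extremal :
  num_motifs pi S = #|` S| ^ (L %/ n) <-> range_mixing.
Proof.
have [b [bE bfib bneq]] := exists_range_block_index.
split=> [eqS g | mixS].
  have [|||||x _ xg] := @motifs_extremal_product _ _ _ _ _ range_class b n
    n_gt0 bfib [set: 'I_q] [set: S] _ _ _ _ g.
  - by move=> i j _ _; apply: bneq.
  - move=> x y _ _ eqxy.
    by apply: range_class_inj => i; apply: eqxy; rewrite inE.
  - by rewrite -(num_motifs_range bE) eqS cardfE cardsT card_ord.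
  - by apply/card_gt0P; exists (g (tagnat.sig1 (Ordinal p_gt0))); rewrite inE.
  - by move=> i _; rewrite inE.
  by exists x => i; apply/range_classE/xg; rewrite inE.
apply/eqP; rewrite eqn_leq num_motifs_le/= (num_motifs_range bE) cardfE.
have := card_motifs_product n_gt0 bfib range_class_inj.
rewrite card_ord; apply=> g; have [x xP] := mixS g; exists x => i.
exact/range_classE.
Qed.

Lemma range_mixingP : range_mixing <->
  exists T : forall i : 'I_q, set 'rV[R]_(ps i),
    [set` S]%classic = block_product T.
Proof.
split=> [mixS | [T eqS] g].
  exists (fun i => [set submxrow x i | x in [set` S]]%classic).
  apply/seteqP; split=> [x /= xS i | x xT]; first by exists x.
  have exy i : exists y : S, submxrow (val y) i = submxrow x i.
    by have [y yS <-] := xT i; exists [` yS].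
  have [g gP] := fin_all_exists exy.
  have [z zP] := mixS g.
  have -> : x = val z by apply/mxrowP => i; rewrite zP gP.
  exact: valP.
pose x : point := (\mxrow_i submxrow (val (g i)) i)%R.
have xS : x \in S.
  suff : [set` S]%classic x by [].
  rewrite eqS => i; rewrite mxrowK.
  have : [set` S]%classic (val (g i)) by exact: valP.
  by rewrite eqS; apply.
by exists [` xS] => i; rewrite mxrowK.
Qed.

End Points.

(** Take [r] points on one coordinate axis: they agree in every range but one, so any mixture of
    them is again one of them. *)
Lemma exists_extremal r :
  exists2 S : {fset point}, #|` S| = r & range_mixing S.
Proof.
pose j0 := Ordinal p_gt0.
pose e k : point := (k%:R *: delta_mx ord0 j0)%R.
have e_inj : injective e.
  move=> k l /rowP/(_ j0); rewrite !mxE !eqxx !GRing.mulr1 => /eqP.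
  by rewrite Num.Theory.eqr_nat => /eqP.
pose S : {fset point} := [fset e k | k in iota 0 r].
have eS k : k < r -> e k \in S.
  by move=> lt_kr; apply/imfsetP; exists k; rewrite //= mem_iota.
exists S.
  by rewrite card_imfset//= undup_id ?iota_uniq ?size_iota.
move=> g; exists (g (tagnat.sig1 j0)) => i.
have [-> // | ij] := eqVneq i (tagnat.sig1 j0).
have g0 j : submxrow (val (g j)) i = 0%R.
  have /imfsetP[k _ ->] := valP (g j); apply/rowP => l; rewrite !mxE.
  case: (tagnat.Rank i l =P j0) => [eqj0 | _]; last by rewrite andbF GRing.mulr0.
  by case/eqP: ij; rewrite -eqj0 tagnat.Rank1K.
by rewrite !g0.
Qed.

End Ranges.

Theorem theorem4 (R : realType) (L n q : nat) (ps : 'I_q -> nat)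
    (p_gt0 : 0 < \sum_(i < q) ps i)
    (pi : 'I_(\sum_(i < q) ps i) -> {set {set 'I_L}})
    (pi_spec : motif_spec pi)
    (pi_unif : uniform_hypergraph pi n)
    (pi_ranges : same_partition_ranges pi)
    (r : nat) :
  (exists S : {fset 'rV[R]_(\sum_(i < q) ps i)},
     #|` S| = r /\ num_motifs pi S = r ^ (L %/ n)) /\
  (forall S : {fset 'rV[R]_(\sum_(i < q) ps i)},
     #|` S| = r -> num_motifs pi S <= r ^ (L %/ n)) /\
  (forall S : {fset 'rV[R]_(\sum_(i < q) ps i)},
     #|` S| = r ->
     (num_motifs pi S = r ^ (L %/ n) <->
      exists T : forall i : 'I_q, set 'rV[R]_(ps i),
        [set` S]%classic = block_product T)).
Proof.
wlog n_gt0 : n pi_unif / 0 < n => [wlog_n | ].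
  have [n0 | n_gt0] := posnP n; last exact: wlog_n.
  (* An edge size [n = 0] means that there is no edge, hence [L = 0]; then [n] can
     be replaced by [1]. *)
  have no_edge e : e \in hyperedges pi -> False.
    move=> e_edge; have := pi_unif e e_edge; rewrite n0 => /cards0_eq e0.
    have /flatten_mapP[m _] := e_edge; rewrite mem_enum e0 => em.
    by have /and3P[_ _ /negP] := pi_spec m.
  have L0 : L = 0.
    have /and3P[/eqP cov _ _] := pi_spec (Ordinal p_gt0).
    apply/eqP; rewrite -leqn0 leqNgt; apply/negP => L_gt0.
    have := boot.finset.in_setT (Ordinal L_gt0).
    rewrite -cov => /bigcupP[B Bm _]; apply: (no_edge B); apply/flatten_mapP.
    by exists (Ordinal p_gt0); rewrite mem_enum.
  have -> : L %/ n = L %/ 1 by rewrite L0 !div0n.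
  by apply: wlog_n => // e /no_edge.
split; [|split=> [S <- | S <-]].
- have [S cardS mixS] := exists_extremal R p_gt0 r.
  by exists S; rewrite -{2}cardS; split=> //; apply/num_motifs_extremal.
- exact: num_motifs_le.
- by rewrite -range_mixingP; apply: num_motifs_extremal.
Qed.
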